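(* Let $\gamma(\sigma)=(s(\sigma),\theta(\sigma))$ be a nonconstant geodesic of the Cigar Ricci--Bourguignon soliton, with affine parameter $\sigma$, and let $\ell=\tanh^2(s)\,\dot\theta$ and $k=\dot s^2+\tanh^2(s)\,\dot\theta^2$ be its conserved angular momentum and speed parameter. Geodesics are of two types: (1) Radial geodesics ($\ell=0$): these satisfy $\theta=\text{const}$ and $$s(\sigma)=\pm\sqrt{k}\,\sigma+s_0,\qquad r(\sigma)=\sqrt{E}\,\sinh(\pm\sqrt{k}\,\sigma+s_0).$$ Every radial geodesic passes through the origin $r=0$. (2) Non-radial geodesics ($\ell\neq0$, with $k>\ell^2$): after choosing the origin of $\sigma$ appropriately, these satisfy $$\cosh s(\sigma)=\sqrt{\frac{k}{k-\ell^2}}\;\cosh\!\bigl(\sqrt{k-\ell^2}\,\sigma\bigr),\qquad \dot\theta=\ell\coth^2 s.$$ These geodesics have a unique turning point at $s_{\min}$ where $\dot s=0$, given by $$\coth^2 s_{\min}=\frac{k}{\ell^2},\qquad r_{\min}=\sqrt{E}\,\sinh s_{\min}=\sqrt{\frac{E\,\ell^2}{k-\ell^2}} .$$ They escape to infinity in both directions: $r(\sigma)\to\infty$ as $\sigma\to\pm\infty$.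
   Context: Fix $\rho,t\in\mathbb{R}$ and $E=e^{4(1-2\rho)t}>0$. The Cigar Ricci--Bourguignon soliton is $\mathbb{R}^2$ with $g=\frac{dx^2+dy^2}{E+x^2+y^2}$. With $x=r\cos\theta$, $y=r\sin\theta$, $r=\sqrt{E}\sinh s$, $s\in[0,\infty)$, the metric is $g=ds^2+\tanh^2(s)\,d\theta^2$. Dots denote $d/d\sigma$. Geodesics are taken to be maximal (defined for all $\sigma\in\mathbb{R}$). For radial geodesics, negative values of $s$ (and $r$) denote points on the opposite ray, $(s,\theta)\sim(-s,\theta+\pi)$. *)

(* Defs.v *)
From Stdlib Require Import Reals.
From Coquelicot Require Import Coquelicot.
Open Scope R_scope.

Inductive axis : Set := ax | ay.

Definition point := axis -> R.

Definition sum_axis (f : axis -> R) : R := f ax + f ay.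

Definition upd (p : point) (i : axis) (u : R) : point :=
  fun j => match i, j with
           | ax, ax => u
           | ay, ay => u
           | _, _ => p j
           end.

Definition partial (i : axis) (f : point -> R) (p : point) : R :=
  Derive (fun u => f (upd p i u)) (p i).

Definition metric := point -> axis -> axis -> R.

Definition inverse_metric (g : metric) (p : point) (i j : axis) : R :=
  let det := g p ax ax * g p ay ay - g p ax ay * g p ay ax in
  match i, j with
  | ax, ax => g p ay ay / det
  | ax, ay => - g p ax ay / det
  | ay, ax => - g p ay ax / det
  | ay, ay => g p ax ax / det
  end.

Definition christoffel (g : metric) (p : point) (k i j : axis) : R :=
  / 2 * sum_axis (fun l =>
    inverse_metric g p k l *
      (partial i (fun q => g q j l) p + partial j (fun q => g q i l) p
       - partial l (fun q => g q i j) p)).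

(* Both differentiability clauses are needed: [Derive] is total, so
   differentiability of [Derive f] does not entail that of [f]. *)
Definition geodesic (g : metric) (gam : R -> point) : Prop :=
  forall (sig : R) (k : axis),
    ex_derive (fun u => gam u k) sig /\
    ex_derive (Derive (fun u => gam u k)) sig /\
    Derive (Derive (fun u => gam u k)) sig +
      sum_axis (fun i => sum_axis (fun j =>
        christoffel g (gam sig) k i j *
          Derive (fun u => gam u i) sig * Derive (fun u => gam u j) sig)) = 0.

Definition nonconstant (gam : R -> point) : Prop :=
  exists (sig1 sig2 : R) (i : axis), gam sig1 i <> gam sig2 i.

Definition cigar_metric (E : R) : metric :=
  fun p i j =>
    match i, j with
    | ax, ax | ay, ay => 1 / (E + p ax ^ 2 + p ay ^ 2)
    | _, _ => 0
    end.

Definition coth (u : R) : R := cosh u / sinh u.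

Definition angular_momentum (s th : R -> R) (sig : R) : R :=
  tanh (s sig) ^ 2 * Derive th sig.

Definition speed (s th : R -> R) (sig : R) : R :=
  Derive s sig ^ 2 + tanh (s sig) ^ 2 * Derive th sig ^ 2.

(* Differentiable polar coordinates along a curve.  They range over s >= 0,
   except along radial curves (vanishing angular momentum), where negative s
   and r denote points of the opposite ray: (s, th) ~ (- s, th + PI). *)
Record polar_coordinates (E : R) (gam : R -> point) (r s th : R -> R) : Prop := {
  polar_ex_derive_s : forall sig, ex_derive s sig;
  polar_ex_derive_th : forall sig, ex_derive th sig;
  polar_x : forall sig, gam sig ax = r sig * cos (th sig);
  polar_y : forall sig, gam sig ay = r sig * sin (th sig);
  polar_r : forall sig, r sig = sqrt E * sinh (s sig);
  polar_sign : (forall sig, 0 <= s sig) \/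
               (forall sig, angular_momentum s th sig = 0)
}.

(* Main.v *)
Require Import Defs.
From Stdlib Require Import Reals Lra.
From Coquelicot Require Import Coquelicot.
Open Scope R_scope.

(* In Cartesian coordinates let W = E + x^2 + y^2 = E cosh^2 s.  Along a geodesic
   k = (x'^2 + y'^2) / W and l = (x y' - y x') / W are constant, and
   W'' = 4 (k - l^2) W - 2 E k with W'^2 = 4 ((k - l^2) W^2 - E k W).  When l^2 < k this
   linear equation gives W = E k / (k - l^2) cosh^2 (sqrt (k - l^2) (sigma - sigma0)),
   which is the formula for cosh s, and s' = 0 exactly where this cosh is 1.  When l = 0
   the geodesic equation linearizes to x'' = k x, y'' = k y, so the curve stays on a line
   through the origin.  Polar coordinates come from this line when l = 0; when l <> 0 the
   curve avoids the origin and the angle is lifted by integrating l W / (x^2 + y^2). *)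

Lemma is_derive_eq (f : R -> R) (t d d' : R) : is_derive f t d -> d = d' -> is_derive f t d'.
Proof. intros H <-; exact H. Qed.

Lemma is_derive_0_const (f : R -> R) :
  (forall t, is_derive f t 0) -> forall a b, f a = f b.
Proof.
  intros H a b.
  destruct (Rtotal_order a b) as [h|[->|h]]; [|reflexivity|symmetry];
    (apply eq_is_derive; [intros; apply H|exact h]).
Qed.

Ltac known_derivatives :=
  repeat match goal with
  | |- _ /\ _ => split
  | |- True => exact I
  | |- ex_derive _ _ => eexists; eauto
  end.

Ltac subst_derive H :=
  match type of H with is_derive ?f ?t ?d =>
    replace (Derive (fun z => f z) t) with d by (symmetry; exact (is_derive_unique _ _ _ H))
  end.

Lemma exp_solution (n : R) (f : R -> R) :
  (forall t, is_derive f t (n * f t)) -> forall a t, f (a + t) = f a * exp (n * t).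
Proof.
  intros H a t.
  assert (D : forall u, is_derive (fun u => f u * exp (- n * u)) u 0).
  { intro u. auto_derive; [known_derivatives|].
    subst_derive (H u); ring. }
  pose proof (is_derive_0_const _ D (a + t) a) as C; simpl in C.
  replace (f (a + t)) with (f (a + t) * exp (- n * (a + t)) * exp (n * (a + t)))
    by (rewrite Rmult_assoc, <- exp_plus; replace (- n * (a + t) + n * (a + t)) with 0 by ring;
        rewrite exp_0; ring).
  rewrite C, Rmult_assoc, <- exp_plus; do 2 f_equal; ring.
Qed.

Lemma linear_factor_solution (n : R) (u v : R -> R) :
  (forall t, is_derive u t (v t)) -> (forall t, is_derive v t (n ^ 2 * u t)) ->
  forall a t, v (a + t) + n * u (a + t) = (v a + n * u a) * exp (n * t).
Proof.
  intros Hu Hv. apply (exp_solution n (fun t => v t + n * u t)). intro t.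
  auto_derive; [known_derivatives|].
  subst_derive (Hu t); subst_derive (Hv t); ring.
Qed.

Lemma linear_ode_unique (n : R) (u v : R -> R) :
  0 < n ->
  (forall t, is_derive u t (v t)) -> (forall t, is_derive v t (n ^ 2 * u t)) ->
  u 0 = 0 -> v 0 = 0 -> forall t, u t = 0.
Proof.
  intros Hn Hu Hv u0 v0 t.
  pose proof (linear_factor_solution n u v Hu Hv 0 t) as P.
  assert (Hv' : forall t, is_derive v t ((- n) ^ 2 * u t))
    by (intro t'; apply (is_derive_eq _ _ _ _ (Hv t')); ring).
  pose proof (linear_factor_solution (- n) u v Hu Hv' 0 t) as M.
  rewrite u0, v0, Rplus_0_l in P, M. nra.
Qed.

Lemma cosh_solution (n c : R) (u v : R -> R) :
  0 < n -> 0 < c ->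
  (forall t, is_derive u t (v t)) -> (forall t, is_derive v t (n ^ 2 * u t)) ->
  (forall t, v t ^ 2 = n ^ 2 * (u t ^ 2 - c ^ 2)) -> (forall t, 0 < u t) ->
  exists t0, forall t, u (t0 + t) = c * cosh (n * t).
Proof.
  intros Hn Hc Hu Hv HE Hpos.
  pose proof (linear_factor_solution n u v Hu Hv) as P.
  assert (Hv' : forall t, is_derive v t ((- n) ^ 2 * u t))
    by (intro t'; apply (is_derive_eq _ _ _ _ (Hv t')); ring).
  pose proof (linear_factor_solution (- n) u v Hu Hv') as M.
  assert (F : forall t, (n * u t + v t) * (n * u t - v t) = (n * c) ^ 2)
    by (intro t; generalize (HE t); nra).
  assert (Hnc : 0 < n * c) by nra.
  assert (f0 : 0 < v 0 + n * u 0).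
  { assert (0 < n * u 0) by (generalize (Hpos 0); nra). generalize (F 0); nra. }
  exists (ln (n * c / (v 0 + n * u 0)) / n). set (t0 := _ / n). intro t.
  assert (f1 : v t0 + n * u t0 = n * c).
  { rewrite <- (Rplus_0_l t0), P. unfold t0.
    replace (n * (ln (n * c / (v 0 + n * u 0)) / n)) with (ln (n * c / (v 0 + n * u 0)))
      by (field; lra).
    rewrite exp_ln by (apply Rdiv_lt_0_compat; lra). field; lra. }
  assert (g1 : n * u t0 - v t0 = n * c).
  { apply (Rmult_eq_reg_l (n * c)); [|lra]. generalize (F t0).
    rewrite Rplus_comm, f1. lra. }
  pose proof (P t0 t) as P1. pose proof (M t0 t) as M1.
  rewrite f1 in P1. replace (v t0 + - n * u t0) with (- (n * c)) in M1 by lra.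
  unfold cosh. apply (Rmult_eq_reg_l n); [|lra].
  replace (- (n * t)) with (- n * t) by ring. lra.
Qed.

Definition cigar_ode (E : R) (x y v w : R -> R) : Prop := forall t,
  is_derive x t (v t) /\ is_derive y t (w t) /\
  is_derive v t ((x t * (v t ^ 2 - w t ^ 2) + 2 * y t * v t * w t) / (E + x t ^ 2 + y t ^ 2)) /\
  is_derive w t ((y t * (w t ^ 2 - v t ^ 2) + 2 * x t * v t * w t) / (E + x t ^ 2 + y t ^ 2)).

Lemma weight_pos (E a b : R) : 0 < E -> 0 < E + a ^ 2 + b ^ 2.
Proof. intro; nra. Qed.

Lemma partial_cigar (E : R) (i j k : axis) (p : point) : 0 < E ->
  partial i (fun q => cigar_metric E q j k) p =
    match j, k with
    | ax, ax | ay, ay => - 2 * p i / (E + p ax ^ 2 + p ay ^ 2) ^ 2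
    | _, _ => 0
    end.
Proof.
  intro HE. pose proof (weight_pos E (p ax) (p ay) HE).
  unfold partial, cigar_metric; destruct i, j, k; simpl;
    apply is_derive_unique; auto_derive; try nra; field; nra.
Qed.

Lemma geodesic_cigar_ode (E : R) (gam : R -> point) : 0 < E ->
  geodesic (cigar_metric E) gam ->
  cigar_ode E (fun t => gam t ax) (fun t => gam t ay)
    (Derive (fun t => gam t ax)) (Derive (fun t => gam t ay)).
Proof.
  intros HE H t. pose proof (weight_pos E (gam t ax) (gam t ay) HE) as W.
  destruct (H t ax) as (X1 & X2 & X3). destruct (H t ay) as (Y1 & Y2 & Y3).
  refine (conj (Derive_correct _ _ X1) (conj (Derive_correct _ _ Y1) (conj _ _))).
  - apply (is_derive_eq _ _ _ _ (Derive_correct _ _ X2)).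
    unfold sum_axis, christoffel, sum_axis in X3.
    rewrite !partial_cigar in X3 by exact HE.
    unfold inverse_metric, cigar_metric in X3.
    match type of X3 with _ + ?z = 0 => apply (Rplus_eq_reg_r z); rewrite X3 end.
    field; lra.
  - apply (is_derive_eq _ _ _ _ (Derive_correct _ _ Y2)).
    unfold sum_axis, christoffel, sum_axis in Y3.
    rewrite !partial_cigar in Y3 by exact HE.
    unfold inverse_metric, cigar_metric in Y3.
    match type of Y3 with _ + ?z = 0 => apply (Rplus_eq_reg_r z); rewrite Y3 end.
    field; lra.
Qed.

Lemma cigar_speed_const (E : R) (x y v w : R -> R) : 0 < E -> cigar_ode E x y v w ->
  exists k, forall t, v t ^ 2 + w t ^ 2 = k * (E + x t ^ 2 + y t ^ 2).
Proof.
  intros HE H.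
  set (K := fun t => (v t ^ 2 + w t ^ 2) / (E + x t ^ 2 + y t ^ 2)).
  exists (K 0). intro t.
  rewrite (is_derive_0_const K) with (b := t).
  { unfold K. generalize (weight_pos E (x t) (y t) HE). intro. field; lra. }
  intro u. destruct (H u) as (Hx & Hy & Hv & Hw).
  generalize (weight_pos E (x u) (y u) HE); intro W.
  unfold K; auto_derive; [known_derivatives; lra|].
  subst_derive Hx; subst_derive Hy; subst_derive Hv; subst_derive Hw.
  field; lra.
Qed.

Lemma cigar_momentum_const (E : R) (x y v w : R -> R) : 0 < E -> cigar_ode E x y v w ->
  exists l, forall t, x t * w t - y t * v t = l * (E + x t ^ 2 + y t ^ 2).
Proof.
  intros HE H.
  set (L := fun t => (x t * w t - y t * v t) / (E + x t ^ 2 + y t ^ 2)).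
  exists (L 0). intro t.
  rewrite (is_derive_0_const L) with (b := t).
  { unfold L. generalize (weight_pos E (x t) (y t) HE). intro. field; lra. }
  intro u. destruct (H u) as (Hx & Hy & Hv & Hw).
  generalize (weight_pos E (x u) (y u) HE); intro W.
  unfold L; auto_derive; [known_derivatives; lra|].
  subst_derive Hx; subst_derive Hy; subst_derive Hv; subst_derive Hw.
  field; lra.
Qed.

Lemma cigar_radial_accel (E l k a b p q : R) : 0 < E ->
  p ^ 2 + q ^ 2 = k * (E + a ^ 2 + b ^ 2) -> a * q - b * p = l * (E + a ^ 2 + b ^ 2) ->
  (a * p + b * q) ^ 2 =
    (k - l ^ 2) * (E + a ^ 2 + b ^ 2) ^ 2 - E * k * (E + a ^ 2 + b ^ 2) /\
  p ^ 2 + q ^ 2 +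
    (a * ((a * (p ^ 2 - q ^ 2) + 2 * b * p * q) / (E + a ^ 2 + b ^ 2)) +
     b * ((b * (q ^ 2 - p ^ 2) + 2 * a * p * q) / (E + a ^ 2 + b ^ 2))) =
    2 * (k - l ^ 2) * (E + a ^ 2 + b ^ 2) - E * k.
Proof.
  intros HE Hk Hl. pose proof (weight_pos E a b HE) as HW.
  set (W := E + a ^ 2 + b ^ 2) in *.
  assert (Q : (a * p + b * q) ^ 2 = (k - l ^ 2) * W ^ 2 - E * k * W).
  { replace ((a * p + b * q) ^ 2) with ((W - E) * (p ^ 2 + q ^ 2) - (a * q - b * p) ^ 2)
      by (unfold W; ring).
    rewrite Hk, Hl; ring. }
  split; [exact Q|].
  replace (a * ((a * (p ^ 2 - q ^ 2) + 2 * b * p * q) / W) +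
     b * ((b * (q ^ 2 - p ^ 2) + 2 * a * p * q) / W))
    with (((a * p + b * q) ^ 2 - (a * q - b * p) ^ 2) / W) by (field; lra).
  rewrite Q, Hk, Hl. field; lra.
Qed.

Lemma cosh_pos (u : R) : 0 < cosh u.
Proof. unfold cosh. generalize (exp_pos u) (exp_pos (- u)); lra. Qed.

Lemma cosh_sqr (u : R) : cosh u ^ 2 = 1 + sinh u ^ 2.
Proof.
  assert (exp u * exp (- u) = 1)
    by (rewrite <- exp_plus, Rplus_opp_r; apply exp_0).
  unfold cosh, sinh. nra.
Qed.

Lemma cosh_double (u : R) : cosh (2 * u) = 2 * cosh u ^ 2 - 1.
Proof.
  assert (exp u * exp (- u) = 1)
    by (rewrite <- exp_plus, Rplus_opp_r; apply exp_0).
  unfold cosh. replace (2 * u) with (u + u) by ring.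
  replace (- (u + u)) with (- u + - u) by ring. rewrite !exp_plus. nra.
Qed.

Lemma sinh_pos (u : R) : 0 < u -> 0 < sinh u.
Proof. intro H. rewrite <- sinh_0. apply sinh_lt, H. Qed.

Lemma sinh_eq_0 (u : R) : sinh u = 0 -> u = 0.
Proof. intro H. rewrite <- (arcsinh_sinh u), H. apply arcsinh_0. Qed.

Lemma cosh_sqr_eq_1 (u : R) : cosh u ^ 2 = 1 -> u = 0.
Proof. rewrite cosh_sqr. intro H. apply sinh_eq_0. nra. Qed.

Lemma cosh_ge_affine (u : R) : (1 + u) / 2 <= cosh u.
Proof. unfold cosh. generalize (exp_ineq1_le u) (exp_pos (- u)); lra. Qed.

Lemma cosh_opp (u : R) : cosh (- u) = cosh u.
Proof. unfold cosh. rewrite Ropp_involutive. lra. Qed.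

Lemma cosh_sub_1_le_sinh (u : R) : 0 <= u -> cosh u - 1 <= sinh u.
Proof.
  intro H. unfold cosh, sinh.
  assert (exp (- u) <= 1) by (rewrite <- exp_0; destruct H as [H|<-];
    [left; apply exp_increasing; lra | rewrite Ropp_0; lra]).
  lra.
Qed.

Lemma cosh_sqr_le_inv (a b : R) : 0 <= a -> 0 <= b -> cosh a ^ 2 <= cosh b ^ 2 -> a <= b.
Proof.
  intros Ha Hb. rewrite !cosh_sqr. intro H.
  destruct (Rle_or_lt a b) as [h|h]; [exact h|exfalso].
  assert (sinh b < sinh a) by (apply sinh_lt, h).
  assert (0 <= sinh b) by (destruct Hb as [Hb|<-]; [left; apply sinh_pos, Hb|rewrite sinh_0; lra]).
  nra.
Qed.

Lemma cigar_weight_solution (E l k : R) (x y v w : R -> R) :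
  0 < E -> cigar_ode E x y v w -> 0 < k -> l ^ 2 < k ->
  (forall t, v t ^ 2 + w t ^ 2 = k * (E + x t ^ 2 + y t ^ 2)) ->
  (forall t, x t * w t - y t * v t = l * (E + x t ^ 2 + y t ^ 2)) ->
  exists t0, forall t,
    E + x (t0 + t) ^ 2 + y (t0 + t) ^ 2 =
      E * (k / (k - l ^ 2)) * cosh (sqrt (k - l ^ 2) * t) ^ 2.
Proof.
  intros HE H Hk Hlk HK HL.
  set (m := k - l ^ 2). assert (Hm : 0 < m) by (unfold m; lra).
  assert (Hsq : sqrt m ^ 2 = m) by (apply pow2_sqrt; lra).
  assert (Hn : 0 < sqrt m) by (apply sqrt_lt_R0, Hm).
  set (c := E * k / (2 * m)).
  assert (Hc : 0 < c) by (unfold c; apply Rdiv_lt_0_compat; nra).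
  assert (Hcm : 2 * m * c = E * k) by (unfold c; field; lra).
  destruct (cosh_solution (2 * sqrt m) c
    (fun t => E + x t ^ 2 + y t ^ 2 - c) (fun t => 2 * (x t * v t + y t * w t)))
    as [t0 Ht0]; try lra.
  - intro t. destruct (H t) as (Hx & Hy & _).
    auto_derive; [known_derivatives|]. subst_derive Hx; subst_derive Hy. ring.
  - intro t. destruct (H t) as (Hx & Hy & Hv & Hw).
    destruct (cigar_radial_accel E l k _ _ _ _ HE (HK t) (HL t)) as [_ A].
    auto_derive; [known_derivatives|].
    subst_derive Hx; subst_derive Hy; subst_derive Hv; subst_derive Hw.
    fold m in A. rewrite Rpow_mult_distr, Hsq.
    replace (2 ^ 2 * m * (E + x t ^ 2 + y t ^ 2 - c)) with
      (2 * (2 * m * (E + x t ^ 2 + y t ^ 2) - 2 * m * c)) by ring.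
    rewrite Hcm, <- A. ring.
  - intro t. destruct (cigar_radial_accel E l k _ _ _ _ HE (HK t) (HL t)) as [A _].
    fold m in A. rewrite !Rpow_mult_distr, A, Hsq, <- Hcm. ring.
  - intro t. destruct (cigar_radial_accel E l k _ _ _ _ HE (HK t) (HL t)) as [A _].
    fold m in A. rewrite <- Hcm in A.
    pose proof (weight_pos E (x t) (y t) HE).
    set (W := E + x t ^ 2 + y t ^ 2) in *.
    assert (0 <= m * W * (W - 2 * c)) by (generalize (pow2_ge_0 (x t * v t + y t * w t)); lra).
    assert (0 < m * W) by nra. nra.
  - exists t0. intro t. generalize (Ht0 t). simpl.
    replace (2 * sqrt m * t) with (2 * (sqrt m * t)) by ring.
    rewrite cosh_double. replace (E * (k / m)) with (2 * c) by (unfold c; field; lra).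
    simpl. lra.
Qed.

Lemma tanh_sqr (u : R) : tanh u ^ 2 * cosh u ^ 2 = sinh u ^ 2.
Proof. unfold tanh. field. apply Rgt_not_eq, cosh_pos. Qed.

Lemma polar_weight (E : R) (gam : R -> point) (r s th : R -> R) : 0 < E ->
  polar_coordinates E gam r s th -> forall t,
  E + gam t ax ^ 2 + gam t ay ^ 2 = E * cosh (s t) ^ 2.
Proof.
  intros HE P t.
  rewrite (polar_x _ _ _ _ _ P), (polar_y _ _ _ _ _ P), (polar_r _ _ _ _ _ P), cosh_sqr.
  pose proof (pow2_sqrt E (Rlt_le _ _ HE)) as S. pose proof (sin2_cos2 (th t)) as T.
  unfold Rsqr in T.
  replace (E + (sqrt E * sinh (s t) * cos (th t)) ^ 2 + (sqrt E * sinh (s t) * sin (th t)) ^ 2)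
    with (E + sqrt E ^ 2 * sinh (s t) ^ 2 *
      (sin (th t) * sin (th t) + cos (th t) * cos (th t))) by ring.
  rewrite T, S. ring.
Qed.

Lemma polar_velocity (E : R) (gam : R -> point) (r s th : R -> R) :
  polar_coordinates E gam r s th -> forall t,
  Derive (fun u => gam u ax) t = sqrt E * (cosh (s t) * Derive s t * cos (th t) -
    sinh (s t) * (sin (th t) * Derive th t)) /\
  Derive (fun u => gam u ay) t = sqrt E * (cosh (s t) * Derive s t * sin (th t) +
    sinh (s t) * (cos (th t) * Derive th t)).
Proof.
  intros P t.
  pose proof (polar_ex_derive_s _ _ _ _ _ P t) as Ds.
  pose proof (polar_ex_derive_th _ _ _ _ _ P t) as Dth.
  split.
  - rewrite (Derive_ext _ (fun u => sqrt E * sinh (s u) * cos (th u)))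
      by (intro u; rewrite (polar_x _ _ _ _ _ P), (polar_r _ _ _ _ _ P); reflexivity).
    apply is_derive_unique. auto_derive; [tauto|].
    change (Derive (fun z => s z) t) with (Derive s t).
    change (Derive (fun z => th z) t) with (Derive th t). ring.
  - rewrite (Derive_ext _ (fun u => sqrt E * sinh (s u) * sin (th u)))
      by (intro u; rewrite (polar_y _ _ _ _ _ P), (polar_r _ _ _ _ _ P); reflexivity).
    apply is_derive_unique. auto_derive; [tauto|].
    change (Derive (fun z => s z) t) with (Derive s t).
    change (Derive (fun z => th z) t) with (Derive th t). ring.
Qed.

Lemma polar_conserved (E : R) (gam : R -> point) (r s th : R -> R) : 0 < E ->
  polar_coordinates E gam r s th -> forall t,
  let v := Derive (fun u => gam u ax) t in let w := Derive (fun u => gam u ay) t in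
  gam t ax * w - gam t ay * v =
    angular_momentum s th t * (E + gam t ax ^ 2 + gam t ay ^ 2) /\
  v ^ 2 + w ^ 2 = speed s th t * (E + gam t ax ^ 2 + gam t ay ^ 2).
Proof.
  intros HE P t v w. rewrite (polar_weight E gam r s th HE P).
  destruct (polar_velocity E gam r s th P t) as [Hv Hw]. fold v in Hv. fold w in Hw.
  rewrite Hv, Hw, (polar_x _ _ _ _ _ P), (polar_y _ _ _ _ _ P), (polar_r _ _ _ _ _ P).
  pose proof (pow2_sqrt E (Rlt_le _ _ HE)) as S. pose proof (sin2_cos2 (th t)) as T.
  unfold Rsqr in T. pose proof (tanh_sqr (s t)) as C.
  unfold angular_momentum, speed. split.
  - transitivity (sqrt E ^ 2 * sinh (s t) ^ 2 * Derive th t *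
      (sin (th t) * sin (th t) + cos (th t) * cos (th t))); [ring|].
    rewrite S, T, <- C; ring.
  - transitivity (sqrt E ^ 2 * (cosh (s t) ^ 2 * Derive s t ^ 2 + sinh (s t) ^ 2 * Derive th t ^ 2) *
      (sin (th t) * sin (th t) + cos (th t) * cos (th t))); [ring|].
    rewrite S, T, <- C; ring.
Qed.

Lemma polar_ex_derive_Derive_s (E : R) (gam : R -> point) (r s th : R -> R) : 0 < E ->
  polar_coordinates E gam r s th ->
  (forall t i, ex_derive (Derive (fun u => gam u i)) t) ->
  forall t, ex_derive (Derive s) t.
Proof.
  intros HE P D t.
  pose proof (polar_ex_derive_s _ _ _ _ _ P t) as Ds.
  pose proof (polar_ex_derive_th _ _ _ _ _ P t) as Dth.
  set (v := Derive (fun u => gam u ax)). set (w := Derive (fun u => gam u ay)).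
  assert (Dv : ex_derive v t) by apply D. assert (Dw : ex_derive w t) by apply D.
  assert (HsE : 0 < sqrt E) by (apply sqrt_lt_R0, HE).
  apply (ex_derive_ext (fun u =>
    (v u * cos (th u) + w u * sin (th u)) / (sqrt E * cosh (s u)))).
  - intro u. destruct (polar_velocity E gam r s th P u) as [Hv Hw].
    fold v in Hv; fold w in Hw. rewrite Hv, Hw.
    pose proof (sin2_cos2 (th u)) as T. unfold Rsqr in T. pose proof (cosh_pos (s u)).
    match goal with |- @eq _ ?a ?b => change (@eq R a b) end.
    transitivity (Derive s u * (sin (th u) * sin (th u) + cos (th u) * cos (th u)));
      [field; lra | rewrite T; apply Rmult_1_r].
  - auto_derive. pose proof (cosh_pos (s t)). repeat split; auto; nra.
Qed.

(* s' has the constant value sqrt k or - sqrt k, so s has a single zero; th' vanishes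
   off that zero, and th is continuous there. *)
Lemma radial_coordinates (s th : R -> R) (k : R) : 0 < k ->
  (forall t, ex_derive s t) -> (forall t, ex_derive th t) ->
  (forall t, ex_derive (Derive s) t) ->
  (forall t, angular_momentum s th t = 0) -> (forall t, speed s th t = k) ->
  exists th0 eps s0, (eps = 1 \/ eps = -1) /\
    (forall t, th t = th0) /\ (forall t, s t = eps * sqrt k * t + s0).
Proof.
  intros Hk Ds Dth DDs HL HK.
  assert (Hn : 0 < sqrt k) by (apply sqrt_lt_R0, Hk).
  assert (Hsq : sqrt k ^ 2 = k) by (apply pow2_sqrt; lra).
  assert (S2 : forall t, Derive s t ^ 2 = sqrt k ^ 2).
  { intro t. rewrite Hsq, <- (HK t). pose proof (HL t) as L.
    unfold speed, angular_momentum in *.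
    replace (tanh (s t) ^ 2 * Derive th t ^ 2)
      with (tanh (s t) ^ 2 * Derive th t * Derive th t) by ring.
    rewrite L; ring. }
  assert (S3 : forall t, Derive s t = sqrt k \/ Derive s t = - sqrt k).
  { intro t.
    assert (Z : (Derive s t - sqrt k) * (Derive s t + sqrt k) = 0)
      by (generalize (S2 t); lra).
    destruct (Rmult_integral _ _ Z); [left | right]; lra. }
  assert (SC : forall t, Derive s t = Derive s 0).
  { intro t. destruct (S3 t) as [h|h], (S3 0) as [h0|h0]; try congruence; exfalso;
      (destruct (IVT_gen (Derive s) 0 t 0) as [c [_ Hc]];
        [ intro u; apply continuity_pt_filterlim, (ex_derive_continuous (Derive s)), DDs
        | rewrite h, h0; split; [apply Rmin_case_strong | apply Rmax_case_strong]; lra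
        | generalize (S2 c); rewrite Hc; nra ]). }
  assert (He : exists eps, (eps = 1 \/ eps = -1) /\ Derive s 0 = eps * sqrt k)
    by (destruct (S3 0) as [h|h]; rewrite h; [exists 1 | exists (-1)]; split; auto; ring).
  destruct He as (eps & Heps & Hs0).
  assert (Hs : forall t, s t = eps * sqrt k * t + s 0).
  { intro t.
    assert (C : s t - eps * sqrt k * t = s 0 - eps * sqrt k * 0).
    { apply (is_derive_0_const (fun u => s u - eps * sqrt k * u)). intro u.
      auto_derive; [exact (Ds u)|].
      change (Derive (fun z => s z) u) with (Derive s u). rewrite SC, Hs0; ring. }
    lra. }
  set (t0 := - s 0 / (eps * sqrt k)).
  assert (Hek : eps * sqrt k <> 0) by (destruct Heps as [->| ->]; lra).
  exists (th t0), eps, (s 0). split; [exact Heps|]. split; [|exact Hs]. intro t.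
  destruct (MVT_gen th t0 t (fun _ => 0)) as [c [_ Hc]]; [| |lra].
  - intros u Hu. apply (is_derive_eq _ _ _ _ (Derive_correct _ _ (Dth u))).
    assert (s u <> 0).
    { intro Hsu. rewrite Hs in Hsu.
      assert (u = t0).
      { unfold t0. replace (- s 0) with (u * (eps * sqrt k)) by lra.
        unfold Rdiv. rewrite Rmult_assoc, Rinv_r by exact Hek. ring. }
      subst u. generalize Hu; apply Rmin_case_strong, Rmax_case_strong; lra. }
    generalize (HL u). unfold angular_momentum, tanh. intro Z.
    destruct (Rmult_integral _ _ Z) as [Z'|Z']; [exfalso|exact Z'].
    pose proof (cosh_pos (s u)).
    assert (sinh (s u) <> 0) by (intro h; apply sinh_eq_0 in h; contradiction).
    revert Z'. apply pow_nonzero. unfold Rdiv.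
    apply Rmult_integral_contrapositive_currified; [assumption|apply Rinv_neq_0_compat; lra].
  - intros u _. apply continuity_pt_filterlim, (ex_derive_continuous th), Dth.
Qed.

Lemma is_lim_of_abs_affine_minorant (f : R -> R) (a b t0 : R) : 0 < a ->
  (forall t, a * Rabs (t - t0) + b <= f t) ->
  is_lim f p_infty p_infty /\ is_lim f m_infty p_infty.
Proof.
  intros Ha H. split; apply is_lim_spec; intro M.
  - exists (t0 + (M - b) / a). intros t Ht. generalize (H t) (Rle_abs (t - t0)); intros H1 H2.
    assert (M - b < a * (t - t0)) by (apply Rmult_lt_reg_r with (/ a);
      [apply Rinv_0_lt_compat, Ha | replace (a * (t - t0) * / a) with (t - t0) by (field; lra)];
      unfold Rdiv in Ht; lra).
    nra.
  - exists (t0 - (M - b) / a). intros t Ht.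
    generalize (H t) (Rle_abs (- (t - t0))); rewrite Rabs_Ropp; intros H1 H2.
    assert (M - b < a * (- (t - t0))) by (apply Rmult_lt_reg_r with (/ a);
      [apply Rinv_0_lt_compat, Ha | replace (a * - (t - t0) * / a) with (- (t - t0)) by (field; lra)];
      unfold Rdiv in Ht; lra).
    nra.
Qed.

Lemma unit_vector_angle (c d : R) : c ^ 2 + d ^ 2 = 1 ->
  exists th, c = cos th /\ d = sin th.
Proof.
  intro H. assert (Hc : -1 <= c <= 1) by nra.
  destruct (Rle_or_lt 0 d) as [h|h]; [exists (acos c) | exists (- acos c)];
    rewrite ?cos_neg, ?sin_neg, cos_acos, sin_acos by exact Hc; (split; [reflexivity|]).
  - symmetry; apply sqrt_lem_1; unfold Rsqr; nra.
  - enough (sqrt (1 - c²) = - d) by lra. apply sqrt_lem_1; unfold Rsqr; nra.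
Qed.

Lemma ex_derive_arcsinh_div (c : R) (f : R -> R) (t : R) :
  ex_derive f t -> ex_derive (fun u => arcsinh (f u / c)) t.
Proof.
  intro H. apply (ex_derive_comp arcsinh (fun u => f u / c));
    [|auto_derive; exact H].
  eexists. apply is_derive_Reals, derivable_pt_lim_arcsinh.
Qed.

Lemma cigar_radial_line (E k : R) (x y v w : R -> R) : 0 < E -> 0 < k ->
  cigar_ode E x y v w ->
  (forall t, v t ^ 2 + w t ^ 2 = k * (E + x t ^ 2 + y t ^ 2)) ->
  (forall t, x t * w t - y t * v t = 0) ->
  exists th0, forall t,
    x t = (x t * cos th0 + y t * sin th0) * cos th0 /\
    y t = (x t * cos th0 + y t * sin th0) * sin th0.
Proof.
  intros HE Hk H HK HL.
  set (N := sqrt (v 0 ^ 2 + w 0 ^ 2)).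
  assert (HN2 : N ^ 2 = v 0 ^ 2 + w 0 ^ 2) by (apply pow2_sqrt; nra).
  assert (HN : 0 < N).
  { apply sqrt_lt_R0. rewrite HK. generalize (weight_pos E (x 0) (y 0) HE). nra. }
  destruct (unit_vector_angle (v 0 / N) (w 0 / N)) as (th0 & Hc & Hd).
  { replace ((v 0 / N) ^ 2 + (w 0 / N) ^ 2)
      with ((v 0 ^ 2 + w 0 ^ 2) / N ^ 2) by (field; lra).
    rewrite <- HN2. field; lra. }
  assert (Q : forall t, y t * v 0 - x t * w 0 = 0).
  { apply (linear_ode_unique (sqrt k) (fun t => y t * v 0 - x t * w 0)
      (fun t => w t * v 0 - v t * w 0)).
    - apply sqrt_lt_R0, Hk.
    - intro t. destruct (H t) as (Hx & Hy & _ & _).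
      auto_derive; [known_derivatives|]. subst_derive Hx; subst_derive Hy; ring.
    - intro t. destruct (H t) as (_ & _ & Hv & Hw).
      auto_derive; [known_derivatives|]. subst_derive Hv; subst_derive Hw.
      pose proof (weight_pos E (x t) (y t) HE).
      replace (x t * (v t ^ 2 - w t ^ 2) + 2 * y t * v t * w t)
        with (x t * (v t ^ 2 + w t ^ 2) - 2 * w t * (x t * w t - y t * v t)) by ring.
      replace (y t * (w t ^ 2 - v t ^ 2) + 2 * x t * v t * w t)
        with (y t * (v t ^ 2 + w t ^ 2) + 2 * v t * (x t * w t - y t * v t)) by ring.
      rewrite HL, HK, pow2_sqrt by lra. field; lra.
    - generalize (HL 0); lra.
    - ring. }
  exists th0. intro t.
  assert (P : y t * cos th0 = x t * sin th0).
  { rewrite <- Hc, <- Hd. apply (Rmult_eq_reg_r N); [|lra].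
    replace (y t * (v 0 / N) * N) with (y t * v 0) by (field; lra).
    replace (x t * (w 0 / N) * N) with (x t * w 0) by (field; lra).
    generalize (Q t); lra. }
  pose proof (sin2_cos2 th0) as T. unfold Rsqr in T. split.
  - transitivity (x t * (sin th0 * sin th0 + cos th0 * cos th0)); [rewrite T; ring|].
    transitivity (x t * cos th0 * cos th0 + (x t * sin th0) * sin th0); [ring|].
    rewrite <- P; ring.
  - transitivity (y t * (sin th0 * sin th0 + cos th0 * cos th0)); [rewrite T; ring|].
    transitivity (y t * sin th0 * sin th0 + (y t * cos th0) * cos th0); [ring|].
    rewrite P; ring.
Qed.

Lemma angle_lift (x y v w : R -> R) :
  (forall t, is_derive x t (v t)) -> (forall t, is_derive y t (w t)) ->
  (forall t, continuous v t) -> (forall t, continuous w t) ->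
  (forall t, 0 < x t ^ 2 + y t ^ 2) ->
  exists th, (forall t, ex_derive (fun u => sqrt (x u ^ 2 + y u ^ 2)) t) /\
    (forall t, ex_derive th t) /\ forall t,
    x t = sqrt (x t ^ 2 + y t ^ 2) * cos (th t) /\
    y t = sqrt (x t ^ 2 + y t ^ 2) * sin (th t).
Proof.
  intros Hx Hy Cv Cw Hpos.
  set (rho := fun t => sqrt (x t ^ 2 + y t ^ 2)).
  assert (Hrho : forall t, 0 < rho t) by (intro t; apply sqrt_lt_R0, Hpos).
  assert (Hrho2 : forall t, rho t ^ 2 = x t ^ 2 + y t ^ 2)
    by (intro t; apply pow2_sqrt, Rlt_le, Hpos).
  assert (Drho : forall t, is_derive rho t ((x t * v t + y t * w t) / rho t)).
  { intro t. unfold rho. auto_derive; [known_derivatives; apply Hpos|].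
    subst_derive (Hx t); subst_derive (Hy t).
    change (sqrt (x t * (x t * 1) + y t * (y t * 1))) with (rho t).
    change (sqrt (x t ^ 2 + y t ^ 2)) with (rho t). field.
    apply Rgt_not_eq, Hrho. }
  set (a := fun t => (x t * w t - y t * v t) / rho t ^ 2).
  assert (Ca : forall t, continuous a t).
  { intro t. unfold a, Rdiv.
    assert (Cx : continuous x t) by (apply (ex_derive_continuous x); eexists; apply Hx).
    assert (Cy : continuous y t) by (apply (ex_derive_continuous y); eexists; apply Hy).
    apply (continuous_mult (fun t => x t * w t - y t * v t) (fun t => / rho t ^ 2)).
    - apply (continuous_minus (fun t => x t * w t) (fun t => y t * v t)).
      + apply (continuous_mult x w); auto.
      + apply (continuous_mult y v); auto.
    - apply (ex_derive_continuous (fun t => / rho t ^ 2)).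
      auto_derive. split; [eexists; apply Drho|]. split; [|exact I].
      generalize (Hrho t); nra. }
  destruct (unit_vector_angle (x 0 / rho 0) (y 0 / rho 0)) as (th0 & Hc & Hd).
  { replace ((x 0 / rho 0) ^ 2 + (y 0 / rho 0) ^ 2) with ((x 0 ^ 2 + y 0 ^ 2) / rho 0 ^ 2)
      by (field; apply Rgt_not_eq, Hrho).
    rewrite <- Hrho2. field. apply Rgt_not_eq, Hrho. }
  set (th := fun t => th0 + RInt a 0 t).
  assert (Dth : forall t, is_derive th t (a t)).
  { intro t. apply (is_derive_eq _ _ (0 + a t)); [|ring].
    apply (is_derive_plus (fun _ => th0) (fun t => RInt a 0 t)).
    - apply (is_derive_const th0).
    - apply (is_derive_RInt a (fun t => RInt a 0 t) 0 t); [|apply Ca].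
      apply filter_forall. intro u. apply (RInt_correct a).
      apply (ex_RInt_continuous a). intros z _. apply Ca. }
  assert (th_0 : th 0 = th0)
    by (unfold th; rewrite RInt_point; unfold zero; simpl; ring).
  (* In the frame rotated by th the unit vector (x, y) / rho is at rest. *)
  assert (P : forall t, (x t * cos (th t) + y t * sin (th t)) / rho t = 1).
  { intro t. rewrite (is_derive_0_const
      (fun t => (x t * cos (th t) + y t * sin (th t)) / rho t)) with (b := 0).
    - rewrite th_0.
      replace ((x 0 * cos th0 + y 0 * sin th0) / rho 0)
        with (x 0 / rho 0 * cos th0 + y 0 / rho 0 * sin th0)
        by (field; apply Rgt_not_eq, Hrho).
      rewrite Hc, Hd. generalize (sin2_cos2 th0). unfold Rsqr. lra.
    - intro u. pose proof (Hrho u).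
      auto_derive; [known_derivatives; lra|].
      subst_derive (Hx u); subst_derive (Hy u); subst_derive (Dth u); subst_derive (Drho u).
      unfold a.
      match goal with |- ?z = 0 => replace z with
        ((v u * cos (th u) + w u * sin (th u)) * (rho u ^ 2 - (x u ^ 2 + y u ^ 2)) / rho u ^ 3)
        by (field; lra) end.
      rewrite Hrho2. field; lra. }
  assert (Q : forall t, (y t * cos (th t) - x t * sin (th t)) / rho t = 0).
  { intro t. rewrite (is_derive_0_const
      (fun t => (y t * cos (th t) - x t * sin (th t)) / rho t)) with (b := 0).
    - rewrite th_0.
      replace ((y 0 * cos th0 - x 0 * sin th0) / rho 0)
        with (y 0 / rho 0 * cos th0 - x 0 / rho 0 * sin th0)
        by (field; apply Rgt_not_eq, Hrho).
      rewrite Hc, Hd. ring.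
    - intro u. pose proof (Hrho u).
      auto_derive; [known_derivatives; lra|].
      subst_derive (Hx u); subst_derive (Hy u); subst_derive (Dth u); subst_derive (Drho u).
      unfold a.
      match goal with |- ?z = 0 => replace z with
        ((w u * cos (th u) - v u * sin (th u)) * (rho u ^ 2 - (x u ^ 2 + y u ^ 2)) / rho u ^ 3)
        by (field; lra) end.
      rewrite Hrho2. field; lra. }
  exists th. split; [intro t; eexists; apply Drho|].
  split; [intro t; eexists; apply Dth|]. intro t. fold (rho t).
  pose proof (Hrho t) as Hr. pose proof (sin2_cos2 (th t)) as T. unfold Rsqr in T.
  assert (P' : x t * cos (th t) + y t * sin (th t) = rho t)
    by (generalize (P t); intro h; apply (Rmult_eq_reg_r (/ rho t));
        [unfold Rdiv in h; rewrite h; field; lra | apply Rinv_neq_0_compat; lra]).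
  assert (Q' : y t * cos (th t) - x t * sin (th t) = 0)
    by (generalize (Q t); intro h; apply (Rmult_eq_reg_r (/ rho t));
        [unfold Rdiv in h; rewrite h; ring | apply Rinv_neq_0_compat; lra]).
  split; rewrite <- P'.
  - transitivity (x t * (sin (th t) * sin (th t) + cos (th t) * cos (th t))
      + (y t * cos (th t) - x t * sin (th t)) * sin (th t)); [rewrite T, Q'|]; ring.
  - transitivity (y t * (sin (th t) * sin (th t) + cos (th t) * cos (th t))
      - (y t * cos (th t) - x t * sin (th t)) * cos (th t)); [rewrite T, Q'|]; ring.
Qed.

Lemma cigar_polar_exists (E k l : R) (gam : R -> point) : 0 < E -> 0 < k ->
  cigar_ode E (fun t => gam t ax) (fun t => gam t ay)
    (Derive (fun t => gam t ax)) (Derive (fun t => gam t ay)) ->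
  (forall t, Derive (fun u => gam u ax) t ^ 2 + Derive (fun u => gam u ay) t ^ 2 =
    k * (E + gam t ax ^ 2 + gam t ay ^ 2)) ->
  (forall t, gam t ax * Derive (fun u => gam u ay) t -
    gam t ay * Derive (fun u => gam u ax) t = l * (E + gam t ax ^ 2 + gam t ay ^ 2)) ->
  exists r s th, polar_coordinates E gam r s th.
Proof.
  intros HE Hk H HK HL.
  assert (HsE : 0 < sqrt E) by (apply sqrt_lt_R0, HE).
  assert (Hr : forall r, r = sqrt E * sinh (arcsinh (r / sqrt E)))
    by (intro r; rewrite sinh_arcsinh; field; lra).
  destruct (Req_dec l 0) as [->|Hl].
  - destruct (cigar_radial_line E k _ _ _ _ HE Hk H HK) as [th0 Hth];
      [intro t; rewrite HL; ring|].
    exists (fun t => gam t ax * cos th0 + gam t ay * sin th0),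
      (fun t => arcsinh ((gam t ax * cos th0 + gam t ay * sin th0) / sqrt E)), (fun _ => th0).
    split.
    + intro t. destruct (H t) as (Hx & Hy & _).
      apply (ex_derive_arcsinh_div _ (fun t => gam t ax * cos th0 + gam t ay * sin th0)).
      apply (ex_derive_plus (fun t => gam t ax * cos th0) (fun t => gam t ay * sin th0)).
      * apply (ex_derive_mult (fun t => gam t ax));
          [eexists; exact Hx | apply ex_derive_const].
      * apply (ex_derive_mult (fun t => gam t ay));
          [eexists; exact Hy | apply ex_derive_const].
    + intro t. apply ex_derive_const.
    + intro t. apply Hth.
    + intro t. apply Hth.
    + intro t. apply Hr.
    + right. intro t. unfold angular_momentum. rewrite Derive_const. ring.
  - assert (Hpos : forall t, 0 < gam t ax ^ 2 + gam t ay ^ 2).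
    { intro t. destruct (Req_dec (gam t ax) 0) as [h|h]; [destruct (Req_dec (gam t ay) 0) as [h'|h']|];
        [exfalso | nra | nra].
      generalize (HL t) (weight_pos E (gam t ax) (gam t ay) HE). rewrite h, h'. intros A B.
      assert (C : l * E = 0) by lra. destruct (Rmult_integral _ _ C); lra. }
    destruct (angle_lift (fun t => gam t ax) (fun t => gam t ay)
      (Derive (fun t => gam t ax)) (Derive (fun t => gam t ay))) as (th & Drho & Dth & Hth).
    + intro t. exact (proj1 (H t)).
    + intro t. exact (proj1 (proj2 (H t))).
    + intro t. apply (ex_derive_continuous (Derive (fun t => gam t ax))).
      destruct (H t) as (_ & _ & Hv & _). exact (ex_intro _ _ Hv).
    + intro t. apply (ex_derive_continuous (Derive (fun t => gam t ay))).
      destruct (H t) as (_ & _ & _ & Hw). exact (ex_intro _ _ Hw).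
    + exact Hpos.
    + exists (fun t => sqrt (gam t ax ^ 2 + gam t ay ^ 2)),
        (fun t => arcsinh (sqrt (gam t ax ^ 2 + gam t ay ^ 2) / sqrt E)), th.
      split.
      * intro t.
        apply (ex_derive_arcsinh_div _ (fun t => sqrt (gam t ax ^ 2 + gam t ay ^ 2))), Drho.
      * exact Dth.
      * intro t. apply Hth.
      * intro t. apply Hth.
      * intro t. apply Hr.
      * left. intro t. rewrite <- arcsinh_0. apply arcsinh_le.
        apply Rmult_le_pos; [apply sqrt_pos | apply Rlt_le, Rinv_0_lt_compat, HsE].
Qed.

Lemma nonconstant_speed_pos (E k : R) (gam : R -> point) : 0 < E ->
  nonconstant gam ->
  (forall t i, ex_derive (fun u => gam u i) t) ->
  (forall t, Derive (fun u => gam u ax) t ^ 2 + Derive (fun u => gam u ay) t ^ 2 =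
    k * (E + gam t ax ^ 2 + gam t ay ^ 2)) ->
  0 < k.
Proof.
  intros HE (t1 & t2 & i & Hne) D HK.
  destruct (Rlt_or_le 0 k) as [h|h]; [exact h | exfalso].
  apply Hne, (is_derive_0_const (fun u => gam u i)). intro t.
  apply (is_derive_eq _ _ _ _ (Derive_correct _ _ (D t i))).
  pose proof (HK t) as K. pose proof (weight_pos E (gam t ax) (gam t ay) HE).
  assert (k * (E + gam t ax ^ 2 + gam t ay ^ 2) <= 0) by nra.
  assert (Hv : Derive (fun u => gam u ax) t = 0) by (apply Rsqr_0_uniq; unfold Rsqr; nra).
  assert (Hw : Derive (fun u => gam u ay) t = 0) by (apply Rsqr_0_uniq; unfold Rsqr; nra).
  destruct i; [exact Hv | exact Hw].
Qed.

Lemma nonradial_coordinates (E l k : R) (gam : R -> point) (r s th : R -> R) :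
  0 < E -> polar_coordinates E gam r s th ->
  cigar_ode E (fun t => gam t ax) (fun t => gam t ay)
    (Derive (fun t => gam t ax)) (Derive (fun t => gam t ay)) ->
  (forall t, angular_momentum s th t = l) -> (forall t, speed s th t = k) -> l <> 0 ->
  0 < l ^ 2 < k /\ (forall t, 0 < s t) /\
  (forall t, Derive th t = l * coth (s t) ^ 2) /\
  (forall t, sinh (s t) ^ 2 * Derive s t ^ 2 = (k - l ^ 2) * cosh (s t) ^ 2 - k) /\
  (exists t0, forall t, cosh (s (t0 + t)) =
     sqrt (k / (k - l ^ 2)) * cosh (sqrt (k - l ^ 2) * t)).
Proof.
  intros HE P H HL HK Hl.
  assert (Hl2 : 0 < l ^ 2) by (apply pow2_gt_0, Hl).
  assert (Hs : forall t, 0 < s t).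
  { intro t. destruct (polar_sign _ _ _ _ _ P) as [h|h].
    - destruct (h t) as [h'|h']; [exact h'|].
      exfalso. apply Hl. rewrite <- (HL t). unfold angular_momentum, tanh.
      rewrite <- h', sinh_0. unfold Rdiv. ring.
    - exfalso. apply Hl. rewrite <- (HL t). apply h. }
  assert (Hth : forall t, Derive th t = l * coth (s t) ^ 2).
  { intro t. rewrite <- (HL t). unfold angular_momentum, tanh, coth.
    pose proof (sinh_pos _ (Hs t)). pose proof (cosh_pos (s t)). field. lra. }
  assert (HD : forall t, sinh (s t) ^ 2 * Derive s t ^ 2 = (k - l ^ 2) * cosh (s t) ^ 2 - k).
  { intro t. pose proof (sinh_pos _ (Hs t)). pose proof (cosh_pos (s t)).
    generalize (HK t). unfold speed. rewrite Hth. unfold coth, tanh. intro A.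
    replace ((k - l ^ 2) * cosh (s t) ^ 2 - k) with (k * sinh (s t) ^ 2 - l ^ 2 * cosh (s t) ^ 2)
      by (rewrite cosh_sqr; ring).
    rewrite <- A. field. lra. }
  assert (Hkl : l ^ 2 < k).
  { pose proof (sinh_pos _ (Hs 0)). pose proof (cosh_sqr (s 0)) as C.
    generalize (HD 0). rewrite C. intro A.
    assert (0 <= (k - l ^ 2) * sinh (s 0) ^ 2 - l ^ 2)
      by (generalize (pow2_ge_0 (sinh (s 0) * Derive s 0)); rewrite Rpow_mult_distr; lra).
    nra. }
  refine (conj (conj Hl2 Hkl) (conj Hs (conj Hth (conj HD _)))).
  destruct (cigar_weight_solution E l k _ _ _ _ HE H) as [t0 Ht0]; [lra|exact Hkl| | |].
  - intro t. rewrite <- (HK t). apply (polar_conserved E gam r s th HE P).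
  - intro t. rewrite <- (HL t). apply (polar_conserved E gam r s th HE P).
  - exists t0. intro t. pose proof (Ht0 t) as A. cbv beta in A.
    rewrite (polar_weight E gam r s th HE P) in A.
    assert (Hq : 0 < k / (k - l ^ 2)) by (apply Rdiv_lt_0_compat; lra).
    pose proof (sqrt_lt_R0 _ Hq). pose proof (cosh_pos (s (t0 + t))).
    pose proof (cosh_pos (sqrt (k - l ^ 2) * t)).
    apply Rsqr_inj; [lra | apply Rmult_le_pos; lra |]. rewrite Rsqr_mult, Rsqr_sqrt by lra.
    unfold Rsqr. apply (Rmult_eq_reg_l E); [|lra]. lra.
Qed.

Theorem theorem4p3 (rho t : R) (gam : R -> point) :
  let E := exp (4 * (1 - 2 * rho) * t) in
  geodesic (cigar_metric E) gam ->
  nonconstant gam ->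
  (exists r s th : R -> R, polar_coordinates E gam r s th) /\
  (forall r s th : R -> R,
    polar_coordinates E gam r s th ->
    exists l k : R,
      (forall sig, angular_momentum s th sig = l) /\
      (forall sig, speed s th sig = k) /\
      (l = 0 ->
        (exists th0 : R, forall sig, th sig = th0) /\
        (exists eps s0 : R,
          (eps = 1 \/ eps = -1) /\
          (forall sig, s sig = eps * sqrt k * sig + s0) /\
          (forall sig, r sig = sqrt E * sinh (eps * sqrt k * sig + s0))) /\
        (exists sig, r sig = 0 /\ gam sig ax = 0 /\ gam sig ay = 0)) /\
      (l <> 0 ->
        k > l ^ 2 /\
        (exists sig0 : R, forall sig,
          cosh (s (sig0 + sig)) =
            sqrt (k / (k - l ^ 2)) * cosh (sqrt (k - l ^ 2) * sig)) /\
        (forall sig, Derive th sig = l * coth (s sig) ^ 2) /\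
        (exists sigmin : R,
          (forall sig, Derive s sig = 0 <-> sig = sigmin) /\
          (forall sig, s sigmin <= s sig) /\
          coth (s sigmin) ^ 2 = k / l ^ 2 /\
          r sigmin = sqrt E * sinh (s sigmin) /\
          sqrt E * sinh (s sigmin) = sqrt (E * l ^ 2 / (k - l ^ 2))) /\
        is_lim r p_infty p_infty /\
        is_lim r m_infty p_infty)).
Proof.
  intros E Hgeo Hnc. assert (HE : 0 < E) by apply exp_pos. clearbody E.
  pose proof (geodesic_cigar_ode E gam HE Hgeo) as H.
  destruct (cigar_speed_const E _ _ _ _ HE H) as [k HK].
  destruct (cigar_momentum_const E _ _ _ _ HE H) as [l HL].
  cbv beta in HK, HL.
  assert (Hk : 0 < k)
    by (apply (nonconstant_speed_pos E k gam HE Hnc); [intros u i; exact (proj1 (Hgeo u i)) | exact HK]).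
  split; [exact (cigar_polar_exists E k l gam HE Hk H HK HL)|].
  intros r s th P. exists l, k.
  assert (PL : forall sig, angular_momentum s th sig = l).
  { intro u. destruct (polar_conserved E gam r s th HE P u) as [A _].
    pose proof (weight_pos E (gam u ax) (gam u ay) HE) as W.
    apply (Rmult_eq_reg_r (E + gam u ax ^ 2 + gam u ay ^ 2)); [|lra].
    rewrite <- A. apply HL. }
  assert (PK : forall sig, speed s th sig = k).
  { intro u. destruct (polar_conserved E gam r s th HE P u) as [_ A].
    pose proof (weight_pos E (gam u ax) (gam u ay) HE) as W.
    apply (Rmult_eq_reg_r (E + gam u ax ^ 2 + gam u ay ^ 2)); [|lra].
    rewrite <- A. apply HK. }
  refine (conj PL (conj PK (conj _ _))).
  - intro Hl.
    destruct (radial_coordinates s th k Hk (polar_ex_derive_s _ _ _ _ _ P)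
      (polar_ex_derive_th _ _ _ _ _ P)) as (th0 & eps & s0 & Heps & Hth & Hs); auto.
    + apply (polar_ex_derive_Derive_s E gam r s th HE P). intros u i. exact (proj1 (proj2 (Hgeo u i))).
    + intro u. rewrite <- Hl. apply PL.
    + split; [exists th0; exact Hth|]. split.
      * exists eps, s0. split; [exact Heps|]. split; [exact Hs|].
        intro u. rewrite (polar_r _ _ _ _ _ P), Hs. reflexivity.
      * assert (Hn : 0 < sqrt k) by (apply sqrt_lt_R0, Hk).
        assert (Hek : eps * sqrt k <> 0) by (destruct Heps as [->| ->]; lra).
        exists (- s0 / (eps * sqrt k)).
        rewrite (polar_x _ _ _ _ _ P), (polar_y _ _ _ _ _ P).
        assert (r0 : r (- s0 / (eps * sqrt k)) = 0).
        { rewrite (polar_r _ _ _ _ _ P), Hs.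
          replace (eps * sqrt k * (- s0 / (eps * sqrt k)) + s0) with 0
            by (field; split; [lra | intro h; apply Hek; rewrite h; ring]).
          rewrite sinh_0. ring. }
        rewrite r0. lra.
  - intro Hl.
    destruct (nonradial_coordinates E l k gam r s th HE P H PL PK Hl)
      as ((Hl2 & Hkl) & Hs & Hth & HD & [t0 Ht0]).
    set (m := k - l ^ 2) in *. assert (Hm : 0 < m) by (unfold m; lra).
    assert (Hn : 0 < sqrt m) by (apply sqrt_lt_R0, Hm).
    assert (Hq : 0 < k / m) by (apply Rdiv_lt_0_compat; lra).
    assert (Hqm : m * (k / m) = k) by (field; lra).
    assert (HsE : 0 < sqrt E) by (apply sqrt_lt_R0, HE).
    pose proof (sqrt_lt_R0 _ Hq) as Hsq.
    assert (C0 : cosh (s t0) ^ 2 = k / m).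
    { rewrite <- (Rplus_0_r t0), Ht0, Rmult_0_r, cosh_0, Rmult_1_r. apply pow2_sqrt; lra. }
    assert (CD : forall u, cosh (s u) ^ 2 = k / m * cosh (sqrt m * (u - t0)) ^ 2).
    { intro u. replace u with (t0 + (u - t0)) at 1 by ring.
      rewrite Ht0, Rpow_mult_distr, pow2_sqrt by lra. reflexivity. }
    assert (S0 : sinh (s t0) ^ 2 = l ^ 2 / m).
    { generalize (cosh_sqr (s t0)). rewrite C0. intro A.
      assert (sinh (s t0) ^ 2 = k / m - 1) as -> by lra. unfold m; field. unfold m in Hm; lra. }
    pose proof (sinh_pos _ (Hs t0)) as Sp.
    refine (conj Hkl (conj (ex_intro _ t0 Ht0) (conj Hth (conj _ _)))).
    + exists t0. refine (conj _ (conj _ (conj _ (conj _ _)))).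
      * intro u. pose proof (sinh_pos _ (Hs u)) as Su. generalize (HD u). rewrite CD.
        replace (m * (k / m * cosh (sqrt m * (u - t0)) ^ 2) - k)
          with (m * (k / m) * cosh (sqrt m * (u - t0)) ^ 2 - k) by ring.
        rewrite Hqm. intro A. split.
        -- intro h. rewrite h in A.
           assert (B : sqrt m * (u - t0) = 0) by (apply cosh_sqr_eq_1, (Rmult_eq_reg_l k); lra).
           destruct (Rmult_integral _ _ B); lra.
        -- intros ->. replace (sqrt m * (t0 - t0)) with 0 in A by ring. rewrite cosh_0 in A.
           assert (B : (sinh (s t0) * Derive s t0) * (sinh (s t0) * Derive s t0) = 0) by lra.
           apply Rmult_integral in B.
           assert (C : sinh (s t0) * Derive s t0 = 0) by tauto.
           destruct (Rmult_integral _ _ C); lra.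
      * intro u. apply cosh_sqr_le_inv; [apply Rlt_le, Hs | apply Rlt_le, Hs |].
        rewrite C0, CD, cosh_sqr. generalize (pow2_ge_0 (sinh (sqrt m * (u - t0)))). nra.
      * unfold coth. unfold Rdiv at 1. rewrite Rpow_mult_distr, pow_inv, C0, S0. field. lra.
      * apply (polar_r _ _ _ _ _ P).
      * symmetry. apply sqrt_lem_1; [apply Rlt_le, Rdiv_lt_0_compat; nra | nra |].
        replace (sqrt E * sinh (s t0) * (sqrt E * sinh (s t0)))
          with (sqrt E ^ 2 * sinh (s t0) ^ 2) by ring.
        rewrite pow2_sqrt, S0 by lra. field; lra.
    + apply (is_lim_of_abs_affine_minorant r
        (sqrt E * sqrt (k / m) * sqrt m / 2) (sqrt E * (sqrt (k / m) / 2 - 1)) t0).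
      * assert (0 < sqrt E * sqrt (k / m)) by nra. nra.
      * intro u. rewrite (polar_r _ _ _ _ _ P).
        pose proof (cosh_sub_1_le_sinh (s u) (Rlt_le _ _ (Hs u))) as A.
        replace (s u) with (s (t0 + (u - t0))) in A at 1 by (f_equal; ring).
        rewrite Ht0 in A.
        assert (B : (1 + sqrt m * Rabs (u - t0)) / 2 <= cosh (sqrt m * (u - t0))).
        { apply Rle_trans with (1 := cosh_ge_affine _).
          unfold Rabs; destruct (Rcase_abs (u - t0)); [|lra].
          rewrite <- (cosh_opp (sqrt m * (u - t0))).
          replace (sqrt m * - (u - t0)) with (- (sqrt m * (u - t0))) by ring. lra. }
        replace (sqrt E * sqrt (k / m) * sqrt m / 2 * Rabs (u - t0) + sqrt E * (sqrt (k / m) / 2 - 1))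
          with (sqrt E * (sqrt (k / m) * ((1 + sqrt m * Rabs (u - t0)) / 2) - 1)) by field.
        apply Rmult_le_compat_l; [lra|].
        apply Rle_trans with (2 := A).
        assert (D := Rmult_le_compat_l _ _ _ (Rlt_le _ _ Hsq) B). lra.
Qed.
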